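(* Let $X,Y\in\mathfrak{A}$ be monotonically independent over $\mathfrak{B}$ with respect to $\Phi$ (in this order: the index of $X$ is smaller than the index of $Y$). Then $$\mathfrak{h}_{X+Y}(z)=(\mathfrak{h}_X\circ\mathfrak{h}_Y)(z)$$ for $z$ in a neighborhood of $0\in\mathfrak{B}$.
   Context: $\mathfrak{B}$ is a C$^*$-algebra with norm $\|\cdot\|$, $\mathfrak{A}$ is a $*$-algebra containing $\mathfrak{B}$ as a subalgebra, and $\Phi:\mathfrak{A}\to\mathfrak{B}$ is a positive conditional expectation, i.e. $\Phi(b_1xb_2+y)=b_1\Phi(x)b_2+\Phi(y)$ for $x,y\in\mathfrak{A}$, $b_1,b_2\in\mathfrak{B}$, $\Phi(b)=b$ for $b\in\mathfrak{B}$, and $\Phi(x^*x)\ge0$ for all $x\in\mathfrak{A}$. $\overline{\mathfrak{A}}$ denotes the closure of $\mathfrak{A}$ in the topology given by $X\mapsto\|\Phi(X^*X)\|$, and the continuous extension of $\Phi$ to $\overline{\mathfrak{A}}$ is also denoted $\Phi$. For $X\in\mathfrak{A}$, $\mathfrak{h}_X$ is the $\mathfrak{B}$-valued function $$\mathfrak{h}_X(z)=\Phi\big((1-zX)^{-1}z\big),\qquad (1-zX)^{-1}z=\sum_{n\ge0}(zX)^nz\in\overline{\mathfrak{A}},$$ defined for $z\in\mathfrak{B}$ in a neighborhood of $0$ (namely $\|z\|<\|X\|^{-1}$). Monotonic independence. A family $\{\mathfrak{A}_j\}_{j\in I}$ of subalgebras of $\mathfrak{A}$ indexed by a totally ordered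 set $I$ is monotonically independent over $\mathfrak{B}$ (with respect to $\Phi$) if, given $X_j\in\mathfrak{A}_j$ ($j\in I$): (a) for all $i<j>k$ in $I$ and all $A,B\in\mathfrak{A}$, $\Phi(AX_iX_jX_kB)=\Phi(AX_i\Phi(X_j)X_kB)$; (b) for all $i_m>\dots>i_1<k_1<\dots<k_n$ in $I$: $\Phi(X_{i_m}\cdots X_{i_1})=\Phi(X_{i_m})\cdots\Phi(X_{i_1})$, $\Phi(X_{k_1}\cdots X_{k_n})=\Phi(X_{k_1})\cdots\Phi(X_{k_n})$, and $\Phi(X_{i_m}\cdots X_{i_1}X_{k_1}\cdots X_{k_n})=\Phi(X_{i_m})\cdots\Phi(X_{i_1})\Phi(X_{k_1})\cdots\Phi(X_{k_n})$. Elements $\{X_j\}_{j\in I}$ of $\mathfrak{A}$ are monotonically independent over $\mathfrak{B}$ if the subalgebras of $\mathfrak{A}$ generated by $X_j$ and $\mathfrak{B}$ are monotonically independent over $\mathfrak{B}$. *)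

(* Defs.v *)
(* MathComp-Analysis. *)
From HB Require Import structures.
From mathcomp Require Import all_boot all_order all_algebra.
From mathcomp Require Import complex.
From mathcomp Require Import all_classical all_reals all_analysis.

Set Implicit Arguments.
Unset Strict Implicit.
Unset Printing Implicit Defensive.

Import Order.TTheory GRing.Theory Num.Theory.
Import numFieldNormedType.Exports.

Local Open Scope classical_set_scope.
Local Open Scope ring_scope.

HB.mixin Record hasStar (C : numClosedFieldType) A of GRing.Algebra C A := {
  star : A -> A;
  starK : involutive star;
  starD : {morph star : x y / x + y};
  starM : forall x y : A, star (x * y) = star y * star x;
  starZ : forall (c : C) (x : A), star (c *: x) = c^* *: star x
}.

#[short(type="starAlgType")]
HB.structure Definition StarAlgebra (C : numClosedFieldType) :=
  {A of GRing.Algebra C A & hasStar C A}.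

(* Hierarchy Builder rejects a structure that joins PzSemiRing and NormedModule
   because NumDomain already joins them. So a unital C*-algebra is a complex
   Banach space B with a product, and the convertible type [alg B] carries its
   ring structure. *)
HB.mixin Record isCStar (R : realType) B of CompleteNormedModule R[i] B := {
  cone : B;
  cmul : B -> B -> B;
  cstar : B -> B;
  cmulA : associative cmul;
  cmul1l : left_id cone cmul;
  cmul1r : right_id cone cmul;
  cmulDl : left_distributive cmul +%R;
  cmulDr : right_distributive cmul +%R;
  cone_neq0 : cone != 0;
  cmulZl : forall (c : R[i]) (x y : B), c *: cmul x y = cmul (c *: x) y;
  cmulZr : forall (c : R[i]) (x y : B), c *: cmul x y = cmul x (c *: y);
  cstarK : involutive cstar;
  cstarD : {morph cstar : x y / x + y};
  cstarM : forall x y : B, cstar (cmul x y) = cmul (cstar y) (cstar x);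
  cstarZ : forall (c : R[i]) (x : B), cstar (c *: x) = c^* *: cstar x;
  normM_le : forall x y : B, `|cmul x y| <= `|x| * `|y|;
  norm_cstar : forall x : B, `|cmul (cstar x) x| = `|x| ^+ 2
}.

#[short(type="cstarAlgType")]
HB.structure Definition CStarAlgebra (R : realType) :=
  {B of CompleteNormedModule R[i] B & isCStar R B}.

Definition alg (R : realType) (B : cstarAlgType R) : Type := B.

Section Alg.
Variables (R : realType) (B : cstarAlgType R).

HB.instance Definition _ := GRing.Lmodule.copy (alg B) B.
HB.instance Definition _ := GRing.Zmodule_isNzRing.Build (alg B)
  (@cmulA R B) (@cmul1l R B) (@cmul1r R B) (@cmulDl R B) (@cmulDr R B)
  (@cone_neq0 R B).
HB.instance Definition _ :=
  GRing.Lmodule_isLalgebra.Build R[i] (alg B) (@cmulZl R B).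
HB.instance Definition _ :=
  GRing.Lalgebra_isAlgebra.Build R[i] (alg B) (@cmulZr R B).
HB.instance Definition _ := hasStar.Build R[i] (alg B)
  (@cstarK R B) (@cstarD R B) (@cstarM R B) (@cstarZ R B).

End Alg.

Section Positivity.
Variables (R : realType) (B : cstarAlgType R).

Definition spectrum (a : alg B) : set R[i] :=
  [set l | ~ exists b : alg B, b * (l%:A - a) = 1 /\ (l%:A - a) * b = 1].

(* In the order of R[i], [0 <= l] says that l is real and nonnegative. *)
Definition cstar_pos (a : alg B) : Prop :=
  star a = a /\ forall l, spectrum a l -> 0 <= l.

End Positivity.

Section OverB.
Variables (R : realType) (B : cstarAlgType R) (A : starAlgType R[i]).
Variable iota : {lrmorphism alg B -> A}.

(* The inclusion of B in A is the map iota, which is injective because of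
   the second clause of [positive_conditional_expectation]. *)
Definition star_preserving : Prop :=
  forall b : alg B, iota (star b) = star (iota b).

Definition positive_conditional_expectation (Phi : A -> alg B) : Prop :=
  [/\ forall (b1 b2 : alg B) (x y : A),
        Phi (iota b1 * x * iota b2 + y) = b1 * Phi x * b2 + Phi y,
      forall b : alg B, Phi (iota b) = b
    & forall x : A, cstar_pos (Phi (star x * x))].

(* (Abar, j) is the Hausdorff completion of A for the seminorm
   x |-> `|Phi (x^* x)|^(1/2), and Phibar is the continuous extension of
   Phi to it. *)
Definition is_closure (Phi : A -> alg B) (Abar : completeNormedModType R[i])
    (j : {linear A -> Abar}) (Phibar : Abar -> B) : Prop :=
  [/\ forall x : A, `|j x| ^+ 2 = `|(Phi (star x * x) : B)|,
      dense (range j),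
      continuous Phibar
    & forall x : A, Phibar (j x) = Phi x].

Section Resolvent.
Variables (Abar : completeNormedModType R[i]) (j : {linear A -> Abar}).
Variable Phibar : Abar -> B.

(* Partial sums of the series (1 - zX)^-1 z. *)
Definition resolvent_series (X : A) (z : B) : Abar ^nat :=
  series (fun n => j ((iota z * X) ^+ n * iota z)).

(* A is only a *-algebra, so nothing forces the series to converge for small z:
   this fails in L^2 of a measure whose moments grow too fast. *)
Definition hdef (X : A) (z : B) : Prop := cvgn (resolvent_series X z).

(* Meaningful only when [hdef X z] holds. *)
Definition h (X : A) (z : B) : B := Phibar (limn (resolvent_series X z)).

End Resolvent.

Section Independence.
Variable Phi : A -> alg B.

(* In the second clause, s p is X_{i_m} ... X_{i_1} and q t is
   X_{k_1} ... X_{k_n}, each factor being paired with its index. Factors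
   with the same index need not be equal. *)
Definition monotone_independent (d : Order.disp_t) (I : orderType d)
    (S : I -> set A) : Prop :=
  (forall (i j k : I) (xi xj xk a b : A), (i < j)%O -> (k < j)%O ->
     S i xi -> S j xj -> S k xk ->
     Phi (a * xi * xj * xk * b) = Phi (a * xi * iota (Phi xj) * xk * b)) /\
  (forall (s t : seq (I * A)) (p q : I * A),
     sorted (fun u v : I * A => (v.1 < u.1)%O) (rcons s p) ->
     sorted (fun u v : I * A => (u.1 < v.1)%O) (q :: t) ->
     (p.1 < q.1)%O ->
     (forall u, u \in rcons s p ++ q :: t -> S u.1 u.2) ->
     [/\ Phi (\prod_(u <- rcons s p) u.2) = \prod_(u <- rcons s p) Phi u.2,
         Phi (\prod_(u <- q :: t) u.2) = \prod_(u <- q :: t) Phi u.2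
       & Phi (\prod_(u <- rcons s p ++ q :: t) u.2) =
         \prod_(u <- rcons s p ++ q :: t) Phi u.2]).

(* Subalgebras of A, not necessarily unital, stable under multiplication by
   elements of B; they need not contain B. *)
Definition B_subalgebra (M : set A) : Prop :=
  [/\ forall (c : R[i]) (x y : A), M x -> M y -> M (c *: x + y),
      forall x y : A, M x -> M y -> M (x * y)
    & forall (b : alg B) (x : A), M x -> M (iota b * x) /\ M (x * iota b)].

(* The span of the words b0 X b1 X ... X bn with n >= 1. The constants must
   be left out: if 1 lies in the algebra of some index i < j, then the first
   clause of [monotone_independent], with xi = xk = 1, gives
   Phi (a xj b) = Phi (a (Phi xj) b) for all a and b in A. Hence independence
   of the algebras that also contain B is a stronger condition; see
   [monotone_independent_elts_full]. *)
Definition generated (X : A) : set A := smallest B_subalgebra [set X].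

Definition monotone_independent_elts (d : Order.disp_t) (I : orderType d)
    (X : I -> A) : Prop :=
  monotone_independent (fun i => generated (X i)).

Definition subalgebra (M : set A) : Prop :=
  (forall (c : R[i]) (x y : A), M x -> M y -> M (c *: x + y)) /\
  (forall x y : A, M x -> M y -> M (x * y)).

Lemma monotone_independent_sub (d : Order.disp_t) (I : orderType d)
    (S T : I -> set A) :
  (forall i, S i `<=` T i) -> monotone_independent T ->
  monotone_independent S.
Proof.
move=> ST [Ta Tb]; split=> [i k l xi xk xl a b ik lk Si Sk Sl|s t p q hs ht pq hS].
  by apply: (Ta i k l) => //; apply: ST.
by apply: Tb => // u /hS /ST.
Qed.

Lemma monotone_independent_elts_full (d : Order.disp_t) (I : orderType d)
    (X : I -> A) :
  monotone_independent
    (fun i => smallest subalgebra ([set X i] `|` range iota)) ->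
  monotone_independent_elts X.
Proof.
apply: monotone_independent_sub => i x hx M [[Ml Mm] XM].
apply: hx; split; last by move=> y ->; apply: XM; left.
split=> // b y My; have Mb : M (iota b) by apply: XM; right; exists b.
by split; apply: Mm.
Qed.

End Independence.
End OverB.

(* Main.v *)
Require Import Defs.
From HB Require Import structures.
From mathcomp Require Import all_boot all_order all_algebra.
From mathcomp Require Import separable cyclotomic cyclic complex.
From mathcomp Require Import all_classical all_reals all_analysis.
From mathcomp Require Import ring lra zify.

Set Implicit Arguments.
Unset Strict Implicit.
Unset Printing Implicit Defensive.

Import Order.TTheory GRing.Theory Num.Theory.
Import numFieldNormedType.Exports.

Local Open Scope classical_set_scope.
Local Open Scope ring_scope.

(** Write [P_n(z) = Phi ((zX)^n z)], so that [h_X(z)] is the sum of the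
    [P_n(z)].  Expand [(z(X+Y))^N z] into words in [X] and [Y] and cut each word
    at its [X]s: it becomes [u_0 X u_1 X ... X u_n] with [u_i = (zY)^(a_i) z] and
    [a_0 + ... + a_n + n = N].  Monotone independence lets [Phi] be applied to
    each [u_i] separately: the inner blocks by the first axiom
    ([Phi_inner]), the two outer ones by the second ([Phi_outer]).  With
    [f_a = Phi ((zY)^a z)] this gives

      [Phi ((z(X+Y))^N z) = \sum Phi (f_(a_0) X f_(a_1) X ... X f_(a_n))],

    which is [moment_add]; formally the right-hand side is the part of total
    degree [N] of [\sum_n P_n(w)] for [w = \sum_a f_a = h_Y(z)].

    The analysis has to justify this rearrangement, and nothing bounds [X] or
    [Y]: only the convergence of the three series near [0] is known.
    Three facts replace the norm of [X].

    - Left multiplication by [b] is bounded for the seminorm of [Phi]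
      ([jn_lmul]): a self-adjoint [h] of norm at most 1/2 is the mean of the two
      unitaries [h + i s] and [h - i s] with [s = sqrt (1 - h^2)], and unitaries
      act isometrically.  By polarization [b |-> Phi (x b y)] is bounded
      ([Phi_sandwich]), and by Banach-Steinhaus so is each multilinear map
      [Phi (x b_1 X b_2 X ... b_n X)] ([Phi_word_le]).  Hence [P_n] is continuous.
    - The [P_n] are homogeneous and, near [0], pointwise bounded in [n].  By
      Baire they are uniformly bounded on some ball, and a Cauchy estimate moves
      this ball to [0]; thus [|P_n(z)| <= M (K |z|)^(n+1)] ([moment_bounded]).
    - For small [z] the polynomial [\sum_a f_a T^a] stays small on the circle
      [|T| = 2], so Cauchy's estimate bounds the contribution of total degree
      [m] in the [f_a] to [P_n(w)] by a multiple of [4^-(n+1) 2^-m].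

    The last bound makes the double series converge absolutely; quantitatively
    the [N]-th partial sums of [h_X(w)] and [h_(X+Y)(z)] differ by at most
    a multiple of [2^-N] ([moment_sum_diff_le]). *)

(** * Complex Banach spaces over the reals *)

Lemma normc_re (R : realType) (t : R[i]) : `|t| = (complex.Re `|t|)%:C%C.
Proof. by rewrite normc_def. Qed.

Lemma normc_real (R : realType) (c : R) :
  0 <= c -> complex.Re `|c%:C%C : R[i]| = c.
Proof. by move=> c0; rewrite normc_def /= expr0n /= addr0 sqrtr_sqr ger0_norm. Qed.

Section RealNorm.
Variables (R : realType) (V : normedModType R[i]).

(** Norms of complex normed spaces are values in [R[i]], where the order is
    partial; estimates are easier with values in [R]. *)
Definition nrm (x : V) : R := complex.Re `|x|.

Lemma nrmE (x : V) : `|x| = (nrm x)%:C%C.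
Proof.
have := normr_ge0 x; rewrite /nrm; case: `|x| => a b.
by rewrite lecE /= => /andP[/eqP -> _].
Qed.

Lemma nrm_ge0 x : 0 <= nrm x.
Proof. by have := normr_ge0 x; rewrite nrmE lecR. Qed.

Lemma nrm0 : nrm 0 = 0. Proof. by rewrite /nrm normr0. Qed.

Lemma nrm_eq0 x : nrm x = 0 -> x = 0.
Proof. by move=> x0; apply/normr0_eq0; rewrite nrmE x0. Qed.

Lemma nrmN x : nrm (- x) = nrm x. Proof. by rewrite /nrm normrN. Qed.

Lemma nrmD x y : nrm (x + y) <= nrm x + nrm y.
Proof. by rewrite -lecR raddfD /= -!nrmE ler_normD. Qed.

Lemma nrmB x y : nrm (x - y) <= nrm x + nrm y.
Proof. by rewrite -(nrmN y) nrmD. Qed.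

Lemma nrm_sum I (r : seq I) (P : pred I) (F : I -> V) :
  nrm (\sum_(i <- r | P i) F i) <= \sum_(i <- r | P i) nrm (F i).
Proof.
elim/big_rec2: _ => [|i y1 y2 _ h]; first by rewrite nrm0.
by apply: le_trans (nrmD _ _) _; rewrite lerD2l.
Qed.

Lemma nrmZ (c : R[i]) x : nrm (c *: x) = complex.Re `|c| * nrm x.
Proof. by rewrite {1}/nrm normrZ nrmE (normc_re c) -rmorphM. Qed.

Lemma nrmZR (r : R) x : nrm (r%:C%C *: x) = `|r| * nrm x.
Proof. by rewrite nrmZ normc_def /= expr0n /= addr0 sqrtr_sqr. Qed.

End RealNorm.

(** [V] with scalars restricted to [R], a setting for Baire's theorem, the
    Banach-Steinhaus theorem and the contraction principle.  Its uniform
    structure is that of [V] up to conversion, so limits in the two spaces are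
    the same terms. *)
Definition realify (R : realType) (V : normedModType R[i]) : Type := V.

Section Realify.
Variables (R : realType) (V : normedModType R[i]).
Local Notation W := (realify V).

HB.instance Definition _ := GRing.Zmodule.copy W V.
HB.instance Definition _ := Uniform.copy W V.
(* The default value of [lim] is the point of the space: sharing it keeps
   the completeness statements of V and W convertible. *)
HB.instance Definition _ := Pointed.copy W V.

Let rscale (r : R) (x : W) : W := (r%:C%C *: (x : V)).
Let rscaleA a b v : rscale a (rscale b v) = rscale (a * b) v.
Proof. by rewrite /rscale scalerA rmorphM. Qed.
Let rscale1 : left_id 1 rscale.
Proof. by move=> x; rewrite /rscale scale1r. Qed.
Let rscaleDr : right_distributive rscale +%R.
Proof. by move=> a x y; rewrite /rscale scalerDr. Qed.
Let rscaleDl v : {morph rscale^~ v : a b / a + b}.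
Proof. by move=> a b; rewrite /rscale rmorphD scalerDl. Qed.
HB.instance Definition _ :=
  GRing.Zmodule_isLmodule.Build R W rscaleA rscale1 rscaleDr rscaleDl.

Let rnrmMn (x : W) n : nrm (x *+ n : V) = nrm (x : V) *+ n.
Proof. by rewrite /nrm normrMn raddfMn. Qed.
HB.instance Definition _ := @Num.Zmodule_isNormed.Build R W (@nrm R V)
  (@nrmD R V) (@nrm_eq0 R V) rnrmMn (@nrmN R V).

Let rball (x : W) (e : R) (y : W) := nrm (x - y : V) < e.
Let rball_center x (e : R) : 0 < e -> rball x e x.
Proof. by rewrite /rball subrr nrm0. Qed.
Let rball_sym x y (e : R) : rball x e y -> rball y e x.
Proof. by rewrite /rball -nrmN opprB. Qed.
Let rball_triangle x y z e1 e2 :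
  rball x e1 y -> rball y e2 z -> rball x (e1 + e2) z.
Proof.
rewrite /rball => h1 h2; rewrite -(subrK y x) -addrA.
by apply: le_lt_trans (nrmD _ _) _; apply: ltrD.
Qed.
Let rball_ent : @entourage W = entourage_ rball.
Proof.
rewrite -[LHS]/(@entourage V) -entourage_ballE.
apply/seteqP; split=> E [e /= e0 h].
  have [r er] : exists r, e = r%:C%C.
    by case: e e0 {h} => a b; rewrite ltcE /= => /andP[/eqP -> _]; exists a.
  exists r => /=; first by rewrite -ltcR -er.
  move=> xy xyr; apply: h; rewrite /= -ball_normE /ball_ /= nrmE er ltcR.
  exact: xyr.
exists e%:C%C => /=; first by rewrite ltcR.
by move=> xy; rewrite /= -ball_normE /ball_ /= nrmE ltcR => xyr; apply: h.
Qed.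
HB.instance Definition _ := Uniform_isPseudoMetric.Build R W
  rball_center rball_sym rball_triangle rball_ent.
HB.instance Definition _ := NormedZmod_PseudoMetric_eq.Build R W erefl.

Let rnormZ (l : R) (x : W) : `|l *: x| = `|l| * `|x|.
Proof. exact: nrmZR. Qed.
HB.instance Definition _ :=
  PseudoMetricNormedZmod_Lmodule_isNormedModule.Build R W rnormZ.
End Realify.

HB.instance Definition _ (R : realType) (V : completeNormedModType R[i]) :=
  Uniform_isComplete.Build (realify V) (@cauchy_cvg V).

(** * Square roots in a C*-algebra *)

(** Used for the closedness of the set in which a square root is sought. *)
Lemma lipschitz_closed_le (R : realType) (V W : normedModType R) (f : V -> W) (C r : R) :
  (forall x y, `|f x - f y| <= C * `|x - y|) -> closed [set x | `|f x| <= r].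
Proof.
move=> fC; have fc : continuous f.
  move=> x; apply/cvgrPdist_lt => e e0.
  have C0 : 0 < `|C| + 1 by rewrite ltr_wpDl.
  near=> y; apply: le_lt_trans (fC x y) _.
  apply: (@le_lt_trans _ _ ((`|C| + 1) * `|x - y|)).
    by rewrite ler_wpM2r// (le_trans (ler_norm _))// lerDl.
  rewrite mulrC -ltr_pdivlMr//; near: y.
  by apply: cvgr_dist_lt; [exact: cvg_id | exact: divr_gt0].
apply: (@preimage_closed _ _ (Num.norm \o f) [set y | y <= r]); last exact: closed_le.
by move=> x _; apply: continuous_comp; [exact: fc | exact: norm_continuous].
Unshelve. all: by end_near. Qed.

Section Star.
Variables (C : numClosedFieldType) (A : starAlgType C).
Implicit Types x y : A.

Lemma star0 : star 0 = 0 :> A.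
Proof. by apply: (@addrI _ (star 0)); rewrite -starD !addr0. Qed.
Lemma starN x : star (- x) = - star x.
Proof. by apply/eqP; rewrite -subr_eq0 opprK -starD addNr star0. Qed.
Lemma starB x y : star (x - y) = star x - star y.
Proof. by rewrite starD starN. Qed.
Lemma star1 : star 1 = 1 :> A.
Proof. by have := starM (star 1 : A) 1; rewrite mulr1 !starK mulr1. Qed.

Definition re_part x : A := 2^-1 *: (x + star x).
Definition im_part x : A := (- 'i / 2) *: (x - star x).

Lemma re_im_decomp x : x = re_part x + 'i *: im_part x.
Proof.
have i2 : 'i * (- 'i / 2) = 2^-1 :> C.
  by rewrite mulrA mulrN -expr2 sqrCi opprK mul1r.
rewrite /re_part /im_part scalerA i2 -scalerDr addrACA subrr addr0 -mulr2n.
by rewrite -(scaler_nat 2 x) scalerA mulVf ?scale1r ?pnatr_eq0.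
Qed.

Lemma star_re_part x : star (re_part x) = re_part x.
Proof. by rewrite starZ fmorphV rmorph_nat starD starK addrC. Qed.

Lemma star_im_part x : star (im_part x) = im_part x.
Proof.
rewrite starZ starB starK rmorphM /= rmorphN /= conjCi opprK fmorphV rmorph_nat.
by rewrite /im_part mulNr scaleNr -scalerN opprB.
Qed.
End Star.

Section AlgNorm.
Variables (R : realType) (B : cstarAlgType R).
Implicit Types x y h : alg B.

Definition anorm (x : alg B) : R := nrm (x : B).

Lemma anorm_ge0 x : 0 <= anorm x. Proof. exact: nrm_ge0. Qed.
Lemma anorm0 : anorm 0 = 0. Proof. exact: nrm0. Qed.
Lemma anormN x : anorm (- x) = anorm x. Proof. exact: nrmN. Qed.
Lemma anormD x y : anorm (x + y) <= anorm x + anorm y.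
Proof. exact: nrmD. Qed.
Lemma anormB x y : anorm (x - y) <= anorm x + anorm y.
Proof. exact: nrmB. Qed.
Lemma anormZ (c : R[i]) x : anorm (c *: x) = complex.Re `|c| * anorm x.
Proof. exact: nrmZ. Qed.
Lemma anorm_sum I (r : seq I) (P : pred I) (F : I -> alg B) :
  anorm (\sum_(i <- r | P i) F i) <= \sum_(i <- r | P i) anorm (F i).
Proof. exact: (@nrm_sum R B). Qed.

Lemma anormM x y : anorm (x * y) <= anorm x * anorm y.
Proof. by rewrite -lecR rmorphM /= -!nrmE; exact: normM_le. Qed.

Lemma anorm_starM x : anorm (star x * x) = anorm x ^+ 2.
Proof. 
have := @norm_cstar R B x; rewrite !nrmE -rmorphXn /= => -[]; exact.
Qed.

(** The C*-identity gives [|y|^2 <= |y^*| |y|]; apply this to [x] and [x^*]. *)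
Lemma anorm_star x : anorm (star x) = anorm x.
Proof.
suff le y : anorm y <= anorm (star y).
  by apply/eqP; rewrite eq_le le andbT -{2}(starK x) le.
have := anormM (star y) y; rewrite anorm_starM.
have [->|y0] := eqVneq (anorm y) 0; first by rewrite anorm_ge0.
by rewrite expr2 ler_pM2r // lt_def y0 anorm_ge0.
Qed.

Lemma normc_half : complex.Re `|2^-1 : R[i]| = 2^-1.
Proof.
have e : (2^-1 : R[i]) = (2^-1 : R)%:C%C by rewrite fmorphV /= rmorphMn.
by rewrite e normc_real ?invr_ge0.
Qed.

Lemma anorm_re_part x : anorm (re_part x) <= anorm x.
Proof.
rewrite anormZ normc_half ler_pdivrMl// mulr_natl mulr2n.
by apply: le_trans (anormD _ _) _; rewrite anorm_star.
Qed.

Lemma anorm_im_part x : anorm (im_part x) <= anorm x.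
Proof.
rewrite anormZ normrM normrN normCi mul1r normc_half ler_pdivrMl// mulr_natl mulr2n.
by apply: le_trans (anormB _ _) _; rewrite anorm_star.
Qed.

(** Seek [s = 1 - y]: then [s^2 = 1 - h^2] reads [y = (h^2 + y^2) / 2].  The
    right-hand side is a contraction of ratio 1/2 on the closed set of
    self-adjoint [y] of norm at most 1/2 that commute with [h]. *)
Lemma sqrt_1mX2 h : star h = h -> anorm h <= 2^-1 ->
  exists s, [/\ star s = s, s * h = h * s & s * s = 1 - h * h].
Proof.
move=> hs hle.
pose W := realify B.
pose U : set W := [set y | anorm (y : alg B) <= 2^-1] `&`
  ([set y : W | anorm (star (y : alg B) - y) <= 0] `&`
   [set y : W | anorm ((y : alg B) * h - h * y) <= 0]).
have le0 y : anorm y <= 0 <-> y = 0.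
  split=> [y0|->]; last by rewrite anorm0.
  by apply: (@nrm_eq0 R B); apply/eqP; rewrite eq_le y0 anorm_ge0.
have UE (y : W) : U y <-> [/\ anorm y <= 2^-1, star (y : alg B) = y
     & (y : alg B) * h = h * y].
  split=> [[y1 [/le0 y2 /le0 y3]]|[y1 y2 y3]].
    by split=> //; apply: subr0_eq.
  by split=> //; split; apply/le0; rewrite ?y2 ?y3 subrr.
have cU : closed U.
  apply: closedI; last apply: closedI.
  - by apply: (@lipschitz_closed_le R W W (fun y => y) 1) => x y; rewrite mul1r.
  - apply: (@lipschitz_closed_le R W W (fun y => star (y : alg B) - y) 2).
    suff H (a b : alg B) : anorm (star a - a - (star b - b)) <= 2 * anorm (a - b).
      by move=> a b; apply: H.
    rewrite opprD opprK addrACA (addrC (- a)) -starB -(opprB a b).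
    rewrite mulr_natl mulr2n; apply: le_trans (anormB _ _) _.
    by rewrite anorm_star.
  - apply: (@lipschitz_closed_le R W W (fun y => (y : alg B) * h - h * y)
      (anorm h *+ 2)).
    suff H (a b : alg B) :
        anorm (a * h - h * a - (b * h - h * b)) <= (anorm h *+ 2) * anorm (a - b).
      by move=> a b; apply: H.
    have -> : a * h - h * a - (b * h - h * b) = (a - b) * h - h * (a - b).
      by rewrite mulrBl mulrBr !opprB [LHS]addrACA [RHS]addrACA [- (h * a) - _]addrC.
    apply: le_trans (anormB _ _) _; rewrite mulr2n [leRHS]mulrDl.
    by apply: lerD; [rewrite mulrC|]; apply: anormM.
pose f (y : W) : W := (2^-1 : R[i]) *: (h * h + (y : alg B) * y) : alg B.
have half_gt0 : 0 < 2^-1 :> R by rewrite invr_gt0.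
have fU : set_fun U U f.
  move=> y /UE[y1 y2 y3]; apply/UE; split.
  - rewrite /f anormZ normc_half ler_piMr ?invr_ge0//.
    apply: le_trans (anormD _ _) _.
    have := anormM h h; have := anormM (y : alg B) y.
    have := anorm_ge0 h; have := anorm_ge0 (y : alg B).
    move: y1 hle; nra.
  - rewrite /f starZ fmorphV rmorph_nat.
    by rewrite starD !starM hs y2.
  - rewrite /f -scalerAl -scalerAr mulrDl mulrDr mulrA; congr (_ *: (_ + _)).
    by rewrite -mulrA y3 !mulrA y3.
have [||y Uy fy] := @banach_fixed_point R W U (mkfun_fun fU) _ cU.
- exists (NngNum (ltW half_gt0)); split=> /=; first by rewrite invf_lt1 ?ltr1n.
  suff H (a b : alg B) : anorm a <= 2^-1 -> anorm b <= 2^-1 ->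
      anorm ((2^-1 : R[i]) *: (h * h + a * a) - (2^-1 : R[i]) *: (h * h + b * b)) <=
      2^-1 * anorm (a - b).
    by move=> [a b] [/= /UE[a1 _ _] /UE[b1 _ _]]; apply: H.
  move=> a1 b1; rewrite -scalerBr anormZ normc_half ler_wpM2l ?(ltW half_gt0)//.
  have -> : h * h + a * a - (h * h + b * b) = a * (a - b) + (a - b) * b.
    by rewrite opprD addrACA subrr add0r mulrBr mulrBl addrA subrK.
  apply: le_trans (anormD _ _) _.
  have := anormM a (a - b); have := anormM (a - b) b; have := anorm_ge0 (a - b).
  by move: a1 b1; nra.
- by exists (0 : alg B); apply/UE; rewrite anorm0 star0 mulr0 mul0r (ltW half_gt0).
have [a [a1 a2 fa]] : exists a : alg B,
    [/\ star a = a, a * h = h * a & a = (2^-1 : R[i]) *: (h * h + a * a)].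
  by exists y; move/UE: Uy => [_ y2 y3].
exists (1 - a).
have e : h * h + a * a = 2%:R *: a.
  by rewrite [X in _ = _ *: X]fa scalerA divff ?scale1r.
split.
- by rewrite starB star1 a1.
- by rewrite mulrBl mulrBr a2 mulr1 mul1r.
- have {e} -> : h * h = 2%:R *: a - a * a by rewrite -e addrK.
  rewrite mulrBl mul1r mulrBr mulr1 scaler_nat mulr2n !opprB opprD -!addrA.
  by congr (_ + _); rewrite addrCA.
Qed.

End AlgNorm.

(** * The seminorm of a conditional expectation *)

Section CondExp.
Variables (R : realType) (B : cstarAlgType R) (A : starAlgType R[i]).
Variable iota : {lrmorphism alg B -> A}.
Variable Phi : A -> alg B.
Hypothesis PhiE : positive_conditional_expectation iota Phi.

Lemma PhiD : {morph Phi : x y / x + y}.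
Proof.
by case: PhiE => h _ _ x y; have := h 1 1 x y; rewrite rmorph1 !mul1r !mulr1.
Qed.

Lemma Phi0 : Phi 0 = 0.
Proof. by apply: (@addrI _ (Phi 0)); rewrite -PhiD !addr0. Qed.

Lemma PhiN : {morph Phi : x / - x}.
Proof. by move=> x; apply/eqP; rewrite -subr_eq0 opprK -PhiD addNr Phi0. Qed.

Lemma PhiM b1 b2 x : Phi (iota b1 * x * iota b2) = b1 * Phi x * b2.
Proof. by case: PhiE => h _ _; have := h b1 b2 x 0; rewrite Phi0 !addr0. Qed.

Lemma PhiMl b x : Phi (iota b * x) = b * Phi x.
Proof. by have := PhiM b 1 x; rewrite rmorph1 !mulr1. Qed.

Lemma PhiMr b x : Phi (x * iota b) = Phi x * b.
Proof. by have := PhiM 1 b x; rewrite rmorph1 !mul1r. Qed.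

Lemma Phi_iota b : Phi (iota b) = b. Proof. by case: PhiE. Qed.

Lemma PhiZ c x : Phi (c *: x) = c *: Phi x.
Proof.
have := PhiMl c%:A x.
by rewrite linearZ /= rmorph1 -!scalerAl !mul1r.
Qed.

Lemma Phi_sum I (r : seq I) (P : pred I) (F : I -> A) :
  Phi (\sum_(i <- r | P i) F i) = \sum_(i <- r | P i) Phi (F i).
Proof. exact: (big_morph Phi PhiD Phi0). Qed.

Hypothesis iota_star : star_preserving iota.
Variables (Abar : completeNormedModType R[i]) (j : {linear A -> Abar}).
Hypothesis jE : forall x : A, `|j x| ^+ 2 = `|(Phi (star x * x) : B)|.

Local Notation jn x := (nrm (j x)).

Lemma jnE x : jn x ^+ 2 = anorm (Phi (star x * x)).
Proof. by have := jE x; rewrite !nrmE -rmorphXn /= => -[]. Qed.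

Lemma polarization (x y : A) : 4%:R *: (star y * x) =
  star (x + y) * (x + y) - star (x - y) * (x - y)
  + 'i *: (star (x + 'i *: y) * (x + 'i *: y))
  - 'i *: (star (x - 'i *: y) * (x - 'i *: y)).
Proof.
have e c : star (x + c *: y) * (x + c *: y) = star x * x + (c^* * c) *: (star y * y)
    + (c *: (star x * y) + c^* *: (star y * x)).
  rewrite starD starZ mulrDl !mulrDr -!scalerAl -!scalerAr scalerA.
  by rewrite [c^* *: _ + _]addrC addrACA.
have e1 := e 1; have e2 := e (-1); have e3 := e 'i; have e4 := e (- 'i).
rewrite conjC1 mul1r !scale1r in e1.
rewrite rmorphN1 mulrNN mul1r !scaleNr !scale1r -opprD in e2.
rewrite conjCi mulNr -expr2 sqrCi opprK scale1r scaleNr -scalerBr in e3.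
have ic : (- 'i)^* = 'i :> R[i] by rewrite rmorphN /= conjCi opprK.
rewrite ic mulrN -expr2 sqrCi opprK scale1r !scaleNr in e4.
set P := star x * x + _ in e1 e2 e3 e4.
rewrite (_ : - _ + _ = - ('i *: (star x * y - star y * x))) in e4; last first.
  by rewrite scalerBr opprB addrC.
have sub2 (u : A) : P + u - (P - u) = u + u.
  by rewrite opprB addrC addrA subrK.
rewrite e1 e2 e3 e4 -addrA -scalerBr !sub2 scalerDr scalerA -expr2 sqrCi scaleN1r.
have rt : star x * y + star y * x + (star y * x - star x * y) =
    star y * x + star y * x by rewrite addrC addrA subrK addrC.
by rewrite opprB addrACA rt scaler_nat -!mulr2n -mulrnA.
Qed.

(** A substitute for the Cauchy-Schwarz inequality: polarize, and use the triangle
    inequality of the seminorm. *)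
Lemma Phi_polar_le x y : anorm (Phi (star y * x)) <= (jn x + jn y) ^+ 2.
Proof.
have n4 : complex.Re `|4%:R : R[i]| = 4 by rewrite normr_nat raddfMn.
have n1 : complex.Re `|'i : R[i]| = 1 by rewrite normCi.
have le c : complex.Re `|c : R[i]| = 1 ->
    anorm (Phi (star (x + c *: y) * (x + c *: y))) <= (jn x + jn y) ^+ 2.
  move=> c1; rewrite -jnE ler_sqr ?nnegrE ?addr_ge0 ?nrm_ge0// linearD linearZ.
  by apply: le_trans (nrmD _ _) _; rewrite nrmZ c1 mul1r.
have n0 : complex.Re `|1 : R[i]| = 1 by rewrite normr1.
have le1 := le 1 n0; have le3 := le 'i n1.
have le2 := le (-1) (etrans (congr1 _ (normrN _)) n0).
have le4 := le (-'i) (etrans (congr1 _ (normrN _)) n1).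
rewrite scale1r in le1; rewrite scaleN1r in le2; rewrite scaleNr in le4.
have := congr1 (fun z => anorm (Phi z)) (polarization x y).
rewrite /= !(PhiZ, PhiD, PhiN) anormZ n4 => e.
rewrite -(ler_pM2l (_ : 0 < 4))// e.
have -> z : 4 * z = z + z + z + z :> R by ring.
apply: le_trans (anormB _ _) _; apply: lerD; last by rewrite anormZ n1 mul1r.
apply: le_trans (anormD _ _) _; apply: lerD; last by rewrite anormZ n1 mul1r.
by apply: le_trans (anormB _ _) _; apply: lerD.
Qed.

(** [(ux)^* (ux) = x^* u^* u x]. *)
Lemma jn_isometry u x : star u * u = 1 -> jn (iota u * x) = jn x.
Proof.
move=> uu; apply/eqP; rewrite -(eqrXn2 (_ : 0 < 2)%N) ?nrm_ge0// !jnE.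
by rewrite starM -mulrA -iota_star (mulrA (iota _)) -rmorphM uu rmorph1 mul1r.
Qed.

(** [h] is the mean of the unitaries [h + i s] and [h - i s]. *)
Lemma jn_selfadjoint h x : star h = h -> anorm h <= 2^-1 ->
  jn (iota h * x) <= jn x.
Proof.
move=> hs hle; have [s [ss sh s2]] := sqrt_1mX2 hs hle.
have uu c : c^* = - c -> c ^+ 2 = -1 -> star (h + c *: s) * (h + c *: s) = 1.
  move=> cN c2; rewrite starD starZ cN hs ss mulrDl !mulrDr -!scalerAl -!scalerAr.
  rewrite sh scaleNr addrA addrK scalerA mulNr -(expr2 c) c2 opprK scale1r s2.
  by rewrite addrC subrK.
have i1 := uu 'i (conjCi _) (sqrCi _).
have i2 : star (h - 'i *: s) * (h - 'i *: s) = 1.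
  by rewrite -scaleNr uu// ?sqrrN ?sqrCi// rmorphN /= conjCi.
have := nrmD (j (iota (h + 'i *: s) * x)) (j (iota (h - 'i *: s) * x)).
rewrite (jn_isometry _ i1) (jn_isometry _ i2) -(linearD j) -mulrDl.
rewrite -(linearD iota) /= addrACA subrr addr0.
rewrite -!mulr2n -scaler_nat linearZ /= -scalerAl linearZ /= nrmZ normr_nat.
by rewrite raddfMn /= -[leRHS]mulr_natl ler_pM2l.
Qed.

Lemma jn_lmul b x : anorm b <= 2^-1 -> jn (iota b * x) <= 2 * jn x.
Proof.
move=> hb; rewrite [X in iota X](re_im_decomp b).
have le1 : jn (iota (re_part b) * x) <= jn x.
  by rewrite jn_selfadjoint ?star_re_part// (le_trans (anorm_re_part _)).
have le2 : jn (iota (im_part b) * x) <= jn x.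
  by rewrite jn_selfadjoint ?star_im_part// (le_trans (anorm_im_part _)).
move: (re_part b) (im_part b) le1 le2 => h1 h2 le1 le2.
rewrite linearD linearZ mulrDl -scalerAl linearD linearZ.
apply: le_trans (nrmD _ _) _.
by rewrite nrmZ normCi mul1r mulr_natl mulr2n lerD.
Qed.

(** [Phi (x b y)] pairs [x^*] with [b y], and left multiplication by [b] is
    bounded. *)
Lemma Phi_sandwich x y :
  exists2 C : R, 0 <= C & forall b, anorm (Phi (x * iota b * y)) <= C * anorm b.
Proof.
pose C := (2 * jn y + jn (star x)) ^+ 2.
have C0 : 0 <= C by rewrite sqr_ge0.
have le b : anorm b <= 2^-1 -> anorm (Phi (x * iota b * y)) <= C.
  move=> hb; rewrite -{1}(starK x) -mulrA; apply: le_trans (Phi_polar_le _ _) _.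
  by rewrite ler_sqr ?nnegrE ?addr_ge0 ?mulr_ge0 ?nrm_ge0// lerD2r jn_lmul.
exists (2 * C); first by rewrite mulr_ge0.
move=> b; have [b0|b0] := eqVneq (anorm b) 0.
  have -> : b = 0 by apply: (@nrm_eq0 _ B).
  by rewrite rmorph0 mulr0 mul0r Phi0 !anorm0 mulr0.
have bp : 0 < anorm b by rewrite lt_def b0 anorm_ge0.
pose c : R := (2 * anorm b)^-1.
have c0 : 0 < c by rewrite invr_gt0 mulr_gt0.
have nc : complex.Re `|c%:C%C : R[i]| = c.
  exact/normc_real/ltW.
have cb : c * anorm b = 2^-1 by rewrite /c invfM -mulrA mulVf ?mulr1.
have := le (c%:C%C *: b); rewrite anormZ nc cb => /(_ (lexx _)).
rewrite linearZ /= -scalerAr -scalerAl PhiZ anormZ nc.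
by rewrite mulrC -ler_pdivlMr// /c invrK; move/le_trans; apply; rewrite mulrCA mulrA.
Qed.

End CondExp.

(** * Boundedness of the multilinear moments *)

Section Multilinear.
Variables (R : realType) (B : cstarAlgType R) (A : starAlgType R[i]).
Variable iota : {lrmorphism alg B -> A}.
Variable Phi : A -> alg B.
Hypothesis PhiE : positive_conditional_expectation iota Phi.
Hypothesis iota_star : star_preserving iota.
Variables (Abar : completeNormedModType R[i]) (j : {linear A -> Abar}).
Hypothesis jE : forall x : A, `|j x| ^+ 2 = `|(Phi (star x * x) : B)|.
Local Notation W := (realify B).

Definition word (X : A) (bs : seq (alg B)) : A := \prod_(b <- bs) (iota b * X).

Lemma word_nseq X n z : word X (nseq n z) = (iota z * X) ^+ n.
Proof. by rewrite /word big_nseq -Monoid.iteropE. Qed.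

(** Induction on the number of letters.  For a fixed first letter [b] the
    induction hypothesis, with [x b X] in place of [x], bounds the maps
    [b |-> Phi (x b X b_2 X ... b_n X)] over all [b_2, ..., b_n] of norm 1; each
    of them is bounded by [Phi_sandwich], so Banach-Steinhaus bounds them
    uniformly. *)
Lemma Phi_word_le X n x : exists2 C : R, 0 <= C & forall bs, size bs = n ->
  anorm (Phi (x * word X bs)) <= C * \prod_(b <- bs) anorm b.
Proof.
elim: n x => [|n IH] x.
  exists (anorm (Phi x)); first exact: anorm_ge0.
  by move=> [|//] _; rewrite /word !big_nil !mulr1.
pose N (bs : seq (alg B)) : R := \prod_(b <- bs) anorm b.
have N_ge0 bs : 0 <= N bs by apply: prodr_ge0 => b _; exact: anorm_ge0.
(* Normalizing by the product of the norms turns the bound into a uniform one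
   over a family; when the product vanishes, so does g. *)
pose g (bs : seq (alg B)) (b : alg B) : alg B :=
  ((N bs)^-1)%:C%C *: Phi (x * iota b * (X * word X bs)).
pose F : set (W -> W) := [set f | exists2 bs, size bs = n & f = g bs].
have gle bs b : anorm (g bs b) =
    (N bs)^-1 * anorm (Phi (x * iota b * (X * word X bs))).
  by rewrite /g anormZ normc_real ?invr_ge0.
have [] := @Banach_Steinhauss R W W F _ _ 1.
- move=> _ [bs _ ->]; split.
    move=> r; have [C C0 CP] := Phi_sandwich PhiE iota_star jE x (X * word X bs).
    exists ((N bs)^-1 * (C * r)).
    suff H b : anorm b <= r -> anorm (g bs b) <= (N bs)^-1 * (C * r) by exact: H.
    move=> br; rewrite gle ler_wpM2l ?invr_ge0//.
    by apply: le_trans (CP _) _; rewrite ler_wpM2l.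
  suff H (c : R) (a b : alg B) : g bs (c%:C%C *: a + b) =
      c%:C%C *: g bs a + g bs b.
    by move=> c a b; exact: H.
  rewrite /g rmorphD /= linearZ /= mulrDr mulrDl -!scalerAr -!scalerAl.
  by rewrite (PhiD PhiE) (PhiZ PhiE) scalerDr !scalerA mulrC.
- move=> b; have [C C0 CP] := IH (x * iota (b : alg B) * X).
  exists C => _ [bs bsn ->].
  suff H : anorm (g bs b) <= C by exact: H.
  rewrite gle mulrA; have := CP bs bsn; rewrite -/(N bs).
  have [->|Nbs] := eqVneq (N bs) 0; first by rewrite invr0 mul0r.
  by rewrite ler_pdivrMl 1?mulrC// lt_def Nbs N_ge0.
move=> M MP.
have M1 bs b : size bs = n -> anorm b <= 1 -> anorm (g bs b) <= M.
  by move=> bsn b1; apply: (MP (g bs)) => //; exists bs.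
have M0 : 0 <= M.
  apply: le_trans (anorm_ge0 _) (M1 (nseq n 0) 0 (size_nseq _ _) _).
  by rewrite anorm0.
exists M => // -[//|b bs] [bsn].
rewrite /word !big_cons -/(word X bs) -/(N bs) -mulrA mulrA.
have [Nbs|Nbs] := eqVneq (N bs) 0.
  have [C C0 CP] := IH (x * iota b * X).
  by have := CP bs bsn; rewrite -/(N bs) Nbs !mulr0 !mulrA.
have [b0|b0] := eqVneq (anorm b) 0.
  have -> : b = 0 by apply: (@nrm_eq0 _ B).
  by rewrite rmorph0 mulr0 mul0r (Phi0 PhiE) !anorm0 mul0r mulr0.
have bp : 0 < anorm b by rewrite lt_def b0 anorm_ge0.
have Np : 0 < N bs by rewrite lt_def Nbs N_ge0.
have := M1 bs ((anorm b)^-1%:C%C *: b) bsn.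
rewrite anormZ normc_real ?invr_ge0 ?(ltW bp)// mulVf// => /(_ (lexx _)).
rewrite gle linearZ /= -scalerAr -scalerAl (PhiZ PhiE) anormZ.
rewrite normc_real ?invr_ge0 ?(ltW bp)// ler_pdivrMl// ler_pdivrMl//.
by move/le_trans; apply; rewrite mulrA mulrC.
Qed.

End Multilinear.

(** * Cauchy estimates by roots of unity *)

Lemma prim_root_exists (C : numClosedFieldType) n : (0 < n)%N ->
  exists z : C, n.-primitive_root z.
Proof.
move=> n0; have [r rE] := closed_field_poly_normal ('X^n - 1 : {poly C}).
rewrite (monicP _) ?monicXnsubC// scale1r in rE.
have r_root : all n.-unity_root r.
  by apply/allP => z; rewrite -root_prod_XsubC -rE.
have r_size : (n <= size r)%N.
  by rewrite -ltnS -(size_prod_XsubC r id) -rE size_XnsubC.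
have r_uniq : uniq r.
  by rewrite -separable_prod_XsubC -rE separable_Xn_sub_1// pnatr_eq0 -lt0n.
by have /hasP[z _ zn] := has_prim_root n0 r_root r_uniq r_size; exists z.
Qed.

Lemma sum_prim_root (C : fieldType) n (w : C) k : n.-primitive_root w ->
  \sum_(i < n) w ^+ (i * k) = if (n %| k)%N then n%:R else 0.
Proof.
move=> wn; under eq_bigr do rewrite mulnC exprM.
rewrite (prim_order_dvd wn); have [->|wk] := eqVneq (w ^+ k) 1.
  under eq_bigr do rewrite expr1n.
  by rewrite sumr_const card_ord.
have := subrX1 (w ^+ k) n.
rewrite -exprM mulnC exprM (prim_expr_order wn) expr1n subrr => /esym/eqP.
by rewrite mulf_eq0 subr_eq0 (negPf wk) => /eqP.
Qed.

Section Cauchy.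
Variables (R : realType) (V : normedModType R[i]).

(** The mean over the circle is replaced by the mean over the [D]-th roots of
    unity, which extracts coefficients exactly from sums of [D] terms. *)
Lemma cauchy_estimate D (d : nat -> V) (r S : R) : 0 < r ->
  (forall t : R[i], complex.Re `|t| = r -> nrm (\sum_(i < D) t ^+ i *: d i) <= S) ->
  forall m, (m < D)%N -> nrm (d m) <= S / r ^+ m.
Proof.
move=> r0 dS m mD; have D0 : (0 < D)%N by apply: leq_ltn_trans mD.
have [w wD] := @prim_root_exists R[i] _ D0.
have w1 : `|w| = 1.
  apply/eqP; rewrite -(pexpr_eq1 D0)// -normrX (prim_expr_order wD).
  by rewrite normr1.
pose t k : R[i] := r%:C%C * w ^+ k.
have tr k : complex.Re `|t k| = r.
  by rewrite normrM normrX w1 expr1n mulr1 normc_real// ltW.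
have inner (i : 'I_D) : \sum_(k < D) w ^+ (k * (D - m)) *: (t k ^+ i *: d i) =
    (if i == Ordinal mD then D%:R * (r ^+ m)%:C%C else 0) *: d i.
  under eq_bigr do rewrite scalerA /t exprMn mulrCA -exprM -exprD -mulnDr.
  rewrite -scaler_suml -mulr_sumr (sum_prim_root _ wD).
  have -> : (D %| D - m + i)%N = (i == Ordinal mD).
    rewrite -(inj_eq val_inj) /=; apply/idP/eqP => [|->]; last first.
      by rewrite subnK ?dvdnn// ltnW.
    have iD := ltn_ord i => /dvdnP[[|[|q]]]; nia.
  case: eqP => [->|_]; last by rewrite mulr0.
  by rewrite mulrC rmorphXn.
have e : (D%:R * (r ^+ m)%:C%C) *: d m =
    \sum_(k < D) w ^+ (k * (D - m)) *: \sum_(i < D) t k ^+ i *: d i.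
  under [RHS]eq_bigr do rewrite scaler_sumr.
  rewrite exchange_big /= (eq_bigr _ (fun i _ => inner i)).
  rewrite (bigD1 (Ordinal mD))//= eqxx big1 ?addr0// => i /negPf ->.
  by rewrite scale0r.
have := nrmZ (D%:R * (r ^+ m)%:C%C) (d m).
have -> : complex.Re `|D%:R * (r ^+ m)%:C%C : R[i]| = D%:R * r ^+ m.
  have -> : D%:R * (r ^+ m)%:C%C = (D%:R * r ^+ m)%:C%C :> R[i].
    by rewrite rmorphM rmorph_nat.
  by rewrite normc_real// mulr_ge0// exprn_ge0// ltW.
rewrite e => dE; rewrite ler_pdivlMr ?exprn_gt0// -(@ler_pM2l _ D%:R) ?ltr0n//.
rewrite mulrA mulrAC -dE.
apply: le_trans (nrm_sum _ _ _) _.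
apply: (@le_trans _ _ (\sum_(k < D) S)); last first.
  by rewrite sumr_const card_ord mulr_natl.
apply: ler_sum => k _; rewrite nrmZ normrX w1 expr1n mul1r.
exact: dS (tr k).
Qed.

End Cauchy.

(** * Uniform bounds on the moments near zero *)

(** The open sets [O k] of points where some [P n] exceeds [k] have no common
    point in the given ball, so by Baire one of them is not dense. *)
Lemma baire_pointwise_bounded (R : realType) (V : completeNormedModType R)
    (W : normedModType R) (P : nat -> V -> W) (r : R) : 0 < r ->
  (forall n, continuous (P n)) ->
  (forall z, `|z| < r -> exists M : R, forall n, `|P n z| <= M) ->
  exists z0 (e M : R), 0 < e /\ forall n z, `|z0 - z| < e -> `|P n z| <= M.
Proof.
move=> r0 Pc Pb.
pose O (k : nat) := \bigcup_n [set z | k%:R < `|P n z|].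
have oO k : open (O k).
  apply: bigcup_open => n _; apply: (@open_comp _ _ (Num.norm \o P n) [set y | k%:R < y]).
    by move=> x _; apply: continuous_comp; [exact: Pc | exact: norm_continuous].
  exact: open_gt.
have [k ndO] : exists k, ~ dense (O k).
  apply: contrapT => /forallNP dO.
  have /(_ (ball (0 : V) r)) [||z []] : dense (\bigcap_k O k).
  - by apply: Baire => k; split=> //; apply: contrapT; exact: dO.
  - by exists 0; exact: ballxx.
  - exact: ball_open.
  rewrite -ball_normE /ball_ /= sub0r normrN => /Pb[M MP] Oz.
  have [n _ /=] := Oz (Num.truncn M).+1 I.
  by rewrite ltNge (le_trans (MP n))// ltW// truncnS_gt.
have [U [[z0 [oU Uz0]] UO]] := denseNE ndO.
have /nbhs_ballP[e /= e0 eU] : nbhs z0 U by apply: open_nbhs_nbhs.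
exists z0, e, k%:R; split=> // n z z0z; rewrite leNgt; apply/negP => kP.
suff : (U `&` O k) z by rewrite UO.
split; first by apply: eU; rewrite -ball_normE.
by exists n.
Qed.

Lemma cvg_norm_dominated (R : realType) (V W : normedModType R) (f : V -> W)
    (z0 : V) (C : R) k : (forall z, `|f z - f z0| <= C * (`|z - z0| * `|z| ^+ k)) ->
  f z @[z --> z0] --> f z0.
Proof.
move=> fC.
have lim0 : C * (`|z - z0| * `|z| ^+ k) @[z --> z0] --> (0 : R).
  have <- : C * (`|z0 - z0| * `|z0| ^+ k) = 0 by rewrite subrr normr0 mul0r mulr0.
  apply: cvgM; first exact: cvg_cst.
  apply: cvgM.
    by apply: cvg_norm; apply: cvgB; [exact: cvg_id | exact: cvg_cst].
  have ek := @exprn_continuous R k `|z0|.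
  exact: (continuous_cvg _ ek (@norm_continuous _ _ z0)).
apply/cvgrPdist_lt => e e0; near=> z; rewrite distrC.
apply: le_lt_trans (fC z) (le_lt_trans (ler_norm _) _).
by near: z; apply: (@cvgr0_norm_lt R R^o _ _ _ _ lim0 e e0).
Unshelve. all: by end_near. Qed.

Section Terms.
Variables (R : realType) (B : cstarAlgType R) (A : starAlgType R[i]).
Variable iota : {lrmorphism alg B -> A}.
Variable Phi : A -> alg B.
Hypothesis PhiE : positive_conditional_expectation iota Phi.
Hypothesis iota_star : star_preserving iota.
Variables (Abar : completeNormedModType R[i]) (j : {linear A -> Abar}).
Hypothesis jE : forall x : A, `|j x| ^+ 2 = `|(Phi (star x * x) : B)|.
Local Notation W := (realify B).
Variable X : A.

Definition moment n (z : alg B) : alg B := Phi ((iota z * X) ^+ n * iota z).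

Lemma moment_scale n c z : moment n (c *: z) = c ^+ n.+1 *: moment n z.
Proof.
rewrite /moment linearZ /= -scalerAl exprZn -scalerAl -scalerAr scalerA (PhiZ PhiE).
by rewrite -exprSr.
Qed.

(** The factor [x] on the left makes the induction go through: the first [z] is
    split as [(z - z0) + z0]; the first part is small by [Phi_word_le], the
    second is an instance with [x z0 X] in place of [x]. *)
Lemma moment_continuous_l n x :
  continuous (fun z : W =>
    Phi (x * ((iota (z : alg B) * X) ^+ n * iota (z : alg B))) : W).
Proof.
elim: n x => [|n IH] x z0.
  apply: (@cvg_norm_dominated _ W W _ _ (anorm (Phi x)) 0).
  suff H (z : alg B) :
      anorm (Phi (x * (1 * iota z)) - Phi (x * (1 * iota (z0 : alg B)))) <=
      anorm (Phi x) * (anorm (z - z0) * 1) by exact: H.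
  by rewrite !mul1r mulr1 !(PhiMr PhiE) -mulrBr anormM.
pose f1 (z : W) : W := Phi (x * iota (z - z0 : alg B) * X *
  ((iota (z : alg B) * X) ^+ n * iota (z : alg B))).
pose f2 (z : W) : W := Phi (x * iota (z0 : alg B) * X *
  ((iota (z : alg B) * X) ^+ n * iota (z : alg B))).
have fE (z : alg B) :
    Phi (x * ((iota z * X) ^+ n.+1 * iota z)) = (f1 z : alg B) + f2 z.
  rewrite /f1 /f2 -(PhiD PhiE) -mulrDl -mulrDl -mulrDr -(rmorphD iota).
  by rewrite subrK exprS !mulrA.
have f10 : f1 z0 = 0.
  by rewrite /f1 subrr rmorph0 mulr0 !mul0r (Phi0 PhiE).
rewrite (_ : (fun z : W => _) = (fun z => f1 z + f2 z)); last first.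
  by apply/funext => z; exact: fE.
apply: (@cvgD R W); last exact: IH.
have [C C0 CP] := Phi_word_le PhiE iota_star jE X n.+1 x.
apply: (@cvg_norm_dominated _ W W _ _ C n.+1).
suff H (z : alg B) :
    anorm ((f1 z : alg B) - f1 z0) <= C * (anorm (z - z0) * anorm z ^+ n.+1).
  by exact: H.
rewrite f10 subr0.
have szn : size ((z - z0 : alg B) :: nseq n z) = n.+1 by rewrite /= size_nseq.
have := CP _ szn; rewrite /word !big_cons -/(word iota X _) word_nseq.
rewrite big_nseq -Monoid.iteropE => le.
have -> : f1 z = Phi (x * (iota (z - z0 : alg B) * X * (iota z * X) ^+ n)) * z.
  by rewrite -(PhiMr PhiE) /f1 !mulrA.
apply: le_trans (anormM _ _) _.
have -> : C * (anorm (z - z0 : alg B) * anorm z ^+ n.+1) =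
  C * (anorm (z - z0 : alg B) * anorm z ^+ n) * anorm z by rewrite exprS; ring.
by rewrite ler_wpM2r ?anorm_ge0.
Qed.

Lemma moment_continuous n : continuous (moment n : W -> W).
Proof.
have := @moment_continuous_l n 1.
rewrite (_ : (fun z : W => _) = (moment n : W -> W)) //.
by apply/funext => z; rewrite /moment mul1r.
Qed.

(** With [f = \sum_a f_a T^a], the coefficient of [T^m] is the sum of the
    [f_(a_0) X f_(a_1) X ... X f_(a_n)] over [a_0 + ... + a_n = m]. *)
Definition insertion_poly n (f : {poly alg B}) : {poly A} :=
  (map_poly iota f * X%:P) ^+ n * map_poly iota f.

Definition moment_coef n f m : alg B := Phi (insertion_poly n f)`_m.

Lemma comm_poly_scalar (p : {poly A}) (t : R[i]) : comm_poly p t%:A.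
Proof. by rewrite /comm_poly -scalerAl -scalerAr mul1r mulr1. Qed.

(** The scalar [t] is central, so evaluation at [t] is multiplicative. *)
Lemma moment_horner n f (t : R[i]) :
  moment n f.[t%:A] =
  \sum_(m < size (insertion_poly n f)) t ^+ m *: moment_coef n f m.
Proof.
have e : iota f.[t%:A] = (map_poly iota f).[t%:A].
  by rewrite -horner_map /= linearZ /= rmorph1.
have -> : moment n f.[t%:A] = Phi (insertion_poly n f).[t%:A].
  rewrite /insertion_poly hornerM_comm; last exact: comm_poly_scalar.
  rewrite horner_exp_comm; last exact: comm_poly_scalar.
  rewrite hornerM_comm; last exact: comm_poly_scalar.
  by rewrite hornerC -e.
rewrite horner_coef (Phi_sum PhiE); apply: eq_bigr => m _.
by rewrite exprZn expr1n -scalerAr mulr1 (PhiZ PhiE).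
Qed.

Lemma moment_coef_le n (f : {poly alg B}) r S : 0 < r ->
  (forall t : R[i], complex.Re `|t| = r -> anorm (moment n f.[t%:A]) <= S) ->
  forall m, anorm (moment_coef n f m) <= S / r ^+ m.
Proof.
move=> r0 le m; have [mD|mD] := ltnP m (size (insertion_poly n f)).
  apply: (@cauchy_estimate R B _ (moment_coef n f) r S r0) mD => t tr.
  by have := le t tr; rewrite moment_horner.
have -> : moment_coef n f m = 0 by rewrite /moment_coef nth_default// (Phi0 PhiE).
rewrite anorm0 divr_ge0 ?exprn_ge0 ?(ltW r0)//.
apply: le_trans (anorm_ge0 _) (le r%:C%C _).
by rewrite normc_real ?ltW.
Qed.

Lemma moment_coef0 n f : moment_coef n f 0 = moment n f`_0.
Proof.
rewrite /moment_coef /insertion_poly -horner_coef0.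
have c0 p : comm_poly p (0 : A) by rewrite /comm_poly mul0r mulr0.
rewrite hornerM_comm// horner_exp_comm// hornerM_comm// hornerC.
by rewrite horner_coef0 coef_map.
Qed.

(** Baire bounds the moments on a ball around some [z0].  For small [z] the
    polynomial [t |-> moment n (z + t z0)] has the value [moment n z] at [0],
    and on [|t| = 1] homogeneity reduces it to the point [z0 + t^-1 z] of that
    ball; Cauchy's estimate then bounds [moment n z]. *)
Lemma moment_bounded : (exists2 r : R, 0 < r & forall z : alg B, anorm z < r ->
    exists M : R, forall n, anorm (moment n z) <= M) ->
  exists K M : R, [/\ 0 < K, 0 <= M &
    forall n z, anorm (moment n z) <= M * (K * anorm z) ^+ n.+1].
Proof.
move=> [r r0 rP].
have [z0 [e [M [e0 Me]]]] :=
  @baire_pointwise_bounded R W W moment r r0 moment_continuous rP.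
have M0 : 0 <= M.
  by apply: le_trans (anorm_ge0 _) (Me 0%N z0 _); rewrite subrr normr0.
have small n z : anorm z < e -> anorm (moment n z) <= M.
  move=> ze; pose f : {poly alg B} := z%:P + (z0 : alg B) *: 'X.
  have f0 : f`_0 = z by rewrite coefD coefC coefZ coefX mulr0 addr0.
  have := @moment_coef_le n f 1 M ltr01 _ 0%N; rewrite moment_coef0 f0 expr0 divr1.
  apply=> t t1; have nt : `|t| = 1 by rewrite normc_re t1.
  have t0 : t != 0 by rewrite -normr_eq0 nt oner_eq0.
  have -> : f.[t%:A] = t *: (z0 + t^-1 *: z : alg B).
    rewrite hornerD hornerC hornerZ hornerX -scalerAr mulr1.
    by rewrite scalerDr scalerA mulfV// scale1r addrC.
  rewrite moment_scale anormZ normrX nt expr1n mul1r; apply: Me.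
  suff : anorm (z0 - (z0 + t^-1 *: z) : alg B) < e by [].
  by rewrite opprD addrA subrr sub0r anormN anormZ normfV nt invr1 mul1r.
exists (2 / e), M; split=> //; first by rewrite divr_gt0.
move=> n z; have [nz|nz] := eqVneq (anorm z) 0.
  have -> : z = 0 by apply: (@nrm_eq0 _ B).
  rewrite -[X in moment _ X](scale0r (0 : alg B)) moment_scale expr0n/= scale0r anorm0.
  by rewrite !mulr0 expr0n /= mulr0.
have zp : 0 < anorm z by rewrite lt_def nz anorm_ge0.
set k := 2 / e * anorm z; have k0 : 0 < k by rewrite !mulr_gt0 ?invr_gt0.
have kC : k%:C%C != 0 :> R[i] by rewrite (inj_eq (@complexI _)) gt_eqF.
have -> : z = k%:C%C *: (k^-1%:C%C *: z).
  by rewrite scalerA fmorphV /= mulfV ?scale1r.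
rewrite moment_scale -rmorphXn anormZ normc_real ?exprn_ge0 ?(ltW k0)//.
rewrite mulrC ler_wpM2r ?exprn_ge0 ?(ltW k0)// small//.
rewrite anormZ normc_real ?invr_ge0 ?(ltW k0)//.
have -> : k^-1 * anorm z = e / 2.
  by rewrite /k; field; rewrite nz gt_eqF.
by rewrite gtr_pMr// invf_lt1 ?ltr1n.
Qed.

End Terms.

(** * Monotone independence *)

Section Independence.
Variables (R : realType) (B : cstarAlgType R) (A : starAlgType R[i]).
Variable iota : {lrmorphism alg B -> A}.
Local Notation gen := (generated iota).
Local Notation moment := (moment iota).

Lemma generated_self X : gen X X.
Proof. by move=> M [_ XM]; apply: XM. Qed.

Lemma generatedP X : B_subalgebra iota (gen X).
Proof.
split.
- move=> c x y gx gy M /[dup] MX [[Ml _ _] _]; apply: Ml; [exact: gx|exact: gy].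
- move=> x y gx gy M /[dup] MX [[_ Mm _] _]; apply: Mm; [exact: gx|exact: gy].
- by move=> b x gx; split=> M /[dup] MX [[_ _ Mb] _];
    have [] := Mb b x (gx M MX).
Qed.

Lemma generated0 X : gen X 0.
Proof.
have [h _ _] := generatedP X; have := h (-1) X X (@generated_self X) (@generated_self X).
by rewrite scaleN1r addNr.
Qed.

Lemma generated_sum X I (r : seq I) (F : I -> A) :
  (forall i, gen X (F i)) -> gen X (\sum_(i <- r) F i).
Proof.
move=> h; elim: r => [|i r IH]; rewrite ?big_nil ?big_cons; first exact: generated0.
by have [l _ _] := generatedP X; rewrite -[F i]scale1r; apply: l.
Qed.

Lemma generatedM X x y : gen X x -> gen X y -> gen X (x * y).
Proof. by have [_ m _] := generatedP X; exact: m. Qed.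

Lemma generatedMl X b x : gen X x -> gen X (iota b * x).
Proof. by have [_ _ m] := generatedP X; move/(m b) => []. Qed.

Lemma generatedMr X b x : gen X x -> gen X (x * iota b).
Proof. by have [_ _ m] := generatedP X; move/(m b) => []. Qed.

Variable Phi : A -> alg B.
Hypothesis PhiE : positive_conditional_expectation iota Phi.
Variables (X Y : A).
Hypothesis indep :
  monotone_independent_elts iota Phi (fun i : bool => if i then Y else X).

(** The elements [z], [zYz], [zYzYz], ... all lie in the sum of B and the algebra
    generated by Y, but [z] itself need not lie in the latter. *)
Definition unitized (u : A) := exists b y, gen Y y /\ u = iota b + y.

Lemma unitized_iota b : unitized (iota b).
Proof. by exists b, 0; split; [exact: generated0 | rewrite addr0]. Qed.

(** First axiom of independence with both outer factors equal to [X]; it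
    is trivial for the component of [u] in B. *)
Lemma Phi_inner a b u : unitized u ->
  Phi (a * X * u * X * b) = Phi (a * X * iota (Phi u) * X * b).
Proof.
move=> [c [y [gy ->]]]; have [h _] := indep.
rewrite (PhiD PhiE) (Phi_iota PhiE) (rmorphD iota) !(mulrDr, mulrDl) !(PhiD PhiE).
congr (_ + _); apply: (h false true false) => //; exact: generated_self.
Qed.

(** Second axiom of independence, for the index patterns (Y, X, Y), (Y, X) and
    (X, Y). *)
Lemma Phi_outer u v x : gen X x -> unitized u -> unitized v ->
  Phi (u * x * v) = Phi (iota (Phi u) * x * iota (Phi v)).
Proof.
move=> gx [c [y [gy ->]]] [d [w [gw ->]]]; have [_ h] := indep.
have H v' : v' \in [:: (true, y); (false, x); (true, w)] ->
    gen (if v'.1 then Y else X) v'.2.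
  by rewrite !inE => /or3P[] /eqP ->.
have [yx _ yxw] := h [:: (true, y)] [::] (false, x) (true, w) isT isT isT H.
have [|_ _ xw] := h [::] [::] (false, x) (true, w) isT isT isT.
  by move=> v' v'P; apply: H; rewrite inE v'P orbT.
rewrite /= !big_cons !big_nil !mulr1 in yx yxw xw.
rewrite mulrA in yxw.
rewrite !(PhiD PhiE) !(Phi_iota PhiE) (PhiM PhiE).
rewrite !(mulrDr, mulrDl) !(PhiD PhiE) !(PhiM PhiE) (PhiMr PhiE) yx yxw.
by rewrite -[iota c * x * w]mulrA (PhiMl PhiE) xw !mulrA.
Qed.

Section Poly.
Variable (p : {poly A}) (f : {poly alg B}).
Hypothesis pU : forall i, unitized p`_i.
Hypothesis fE : forall i, f`_i = Phi p`_i.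
Local Notation p' := (map_poly iota f).
Local Notation XP := (X%:P).

Lemma coef_p' i : p'`_i = iota (Phi p`_i).
Proof. by rewrite coef_map fE. Qed.

Lemma Phi_inner_poly (a b : {poly A}) m :
  Phi (a * XP * p * XP * b)`_m = Phi (a * XP * p' * XP * b)`_m.
Proof.
rewrite !coefM !(Phi_sum PhiE); apply: eq_bigr => i _.
rewrite !coefMC !coefM !mulr_suml !(Phi_sum PhiE); apply: eq_bigr => k _.
by rewrite !coefMC coef_p' Phi_inner.
Qed.

Lemma Phi_inner_pow n (a b : {poly A}) m :
  Phi (a * XP * (p * XP) ^+ n * b)`_m = Phi (a * XP * (p' * XP) ^+ n * b)`_m.
Proof.
elim: n a => [//|n IH] a; rewrite !exprS.
have := Phi_inner_poly a ((p * XP) ^+ n * b) m; have := IH (a * XP * p').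
by rewrite !mulrA => <- <-.
Qed.

Lemma generated_pow n i : gen X (XP * (p' * XP) ^+ n)`_i.
Proof.
elim: n i => [|n IH] i.
  rewrite expr0 mulr1 coefC; case: eqP => _; [exact: generated_self|exact: generated0].
rewrite exprS -mulrA coefCM coefM mulr_sumr; apply: generated_sum => k.
by rewrite coef_map; apply: generatedM; [exact: generated_self | exact: generatedMl].
Qed.

(** The inner blocks are replaced first, from left to right: with two factors [X]
    around it, a block may be averaged by [Phi_inner].  What then stands between
    the two outer blocks lies in the algebra generated by [X], as [Phi_outer]
    requires. *)
Lemma Phi_insertion n m : Phi ((p * XP) ^+ n * p)`_m = moment_coef iota Phi X n f m.
Proof.
rewrite /moment_coef /insertion_poly; case: n => [|n].
  by rewrite !expr0 !mul1r coef_p' (Phi_iota PhiE).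
rewrite !exprS Phi_inner_pow -!(mulrA _ XP).
rewrite !coefM !(Phi_sum PhiE); apply: eq_bigr => i _.
rewrite !coefM !mulr_suml !(Phi_sum PhiE); apply: eq_bigr => k _.
by rewrite !coef_p' Phi_outer//; exact: generated_pow.
Qed.
End Poly.

(** The series of [(1 - zY)^-1 z] with a formal variable marking the number of
    [Y]s, truncated so as to be a polynomial.  Coefficients of degree less than
    [K] do not feel the truncation. *)
Definition resolvent_poly K (z : alg B) : {poly A} :=
  \poly_(k < K) ((iota z * Y) ^+ k * iota z).

Lemma resolvent_poly_unitized K z i : unitized (resolvent_poly K z)`_i.
Proof.
rewrite coef_poly; case: ifP => _; last by rewrite -(rmorph0 iota); exact: unitized_iota.
case: i => [|i]; first by rewrite mul1r; exact: unitized_iota.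
exists 0; eexists; split; last by rewrite rmorph0 add0r.
apply: generatedMr; elim: i => [|i IH].
  by rewrite expr1; apply: generatedMl; exact: generated_self.
by rewrite exprS; apply: generatedM => //; apply: generatedMl; exact: generated_self.
Qed.

(** For [m < K] the coefficient of degree [m] of [(pX)^n p] is the sum of the words
    [z V_1 z V_2 ... z] with [n] letters [X] and [m] letters [Y].  Its
    recurrence removes the first letter, as does
    [(z(X+Y))^(N+1) z = zX (z(X+Y))^N z + zY (z(X+Y))^N z]. *)
Lemma expand_sum_resolvent K z N : (N < K)%N ->
  (iota z * (X + Y)) ^+ N * iota z =
  \sum_(n < N.+1) ((resolvent_poly K z * X%:P) ^+ n * resolvent_poly K z)`_(N - n).
Proof.
set p := resolvent_poly K z; pose W n m := ((p * X%:P) ^+ n * p)`_m.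
have p0 : (0 < K)%N -> p`_0 = iota z by move=> K0; rewrite coef_poly K0 mul1r.
have pS k : (k.+1 < K)%N -> p`_k.+1 = iota z * Y * p`_k.
  by move=> kK; rewrite !coef_poly kK (ltnW kK) exprS mulrA.
have WS0 n : (0 < K)%N -> W n.+1 0%N = iota z * X * W n 0%N.
  by move=> K0; rewrite /W exprS -mulrA coefM big_ord1 coefMC p0.
have WSS n m : (m.+1 < K)%N -> W n.+1 m.+1 =
      iota z * X * W n m.+1 + iota z * Y * W n.+1 m.
  move=> mK; rewrite /W exprS -mulrA coefM big_ord_recl subn0 coefMC p0; last first.
    exact: leq_ltn_trans mK.
  rewrite [in X in _ = _ + X]coefM mulr_sumr; congr (_ + _); apply: eq_bigr => i _.
  rewrite !coefMC lift0 subSS pS ?mulrA//.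
  by rewrite (leq_ltn_trans (ltn_ord i)).
elim: N => [|N IH] NK; first by rewrite big_ord1 !mul1r p0.
rewrite exprS -[LHS]mulrA IH ?(ltnW NK)// mulrDr mulrDl !mulr_sumr.
have K0 : (0 < K)%N by apply: leq_ltn_trans NK.
rewrite big_ord_recr/= subnn (big_ord_recl _ (fun n : 'I__ => iota z * Y * _))/= subn0.
rewrite [RHS]big_ord_recl /= subn0 big_ord_recr /= subSS subnn.
rewrite -/(W N.+1 0%N) -/(W 0%N N.+1) WS0// -/(W N 0%N) -/(W 0%N N).
have -> : W 0%N N.+1 = iota z * Y * W 0%N N by rewrite /W !expr0 !mul1r pS.
rewrite [LHS]addrACA [RHS]addrCA [in RHS]addrA [RHS]addrC.
rewrite [LHS]addrC -[LHS]addrA; congr (_ + _).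
rewrite [LHS]addrA; congr (_ + _); rewrite [LHS]addrC -big_split /=.
apply: eq_bigr => i _; rewrite /bump leq0n add1n subSS.
have NiE : (N - i)%N = (N - i.+1).+1 by rewrite subnSK.
rewrite -/(W i.+1 (N - i)%N) -/(W i (N - i)%N) -/(W i.+1 (N - i.+1)%N) NiE WSS//.
by rewrite -NiE (leq_ltn_trans (leq_subr _ _))// ltnW.
Qed.

Lemma moment_add K z N : (N < K)%N ->
  moment Phi (X + Y) N z = \sum_(n < N.+1)
    moment_coef iota Phi X n (\poly_(k < K) moment Phi Y k z) (N - n).
Proof.
move=> NK; rewrite /moment (expand_sum_resolvent _ NK) (Phi_sum PhiE).
apply: eq_bigr => n _; apply: Phi_insertion; first exact: resolvent_poly_unitized.
move=> i; rewrite !coef_poly; case: ifP => // _.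
by rewrite (Phi0 PhiE).
Qed.

(** Makes the moment coefficients independent of the order of truncation. *)
Lemma coefM_low (C : nzRingType) (p q p' q' : {poly C}) m :
  (forall i, (i <= m)%N -> p`_i = p'`_i) -> (forall i, (i <= m)%N -> q`_i = q'`_i) ->
  forall i, (i <= m)%N -> (p * q)`_i = (p' * q')`_i.
Proof.
move=> pp qq i im; rewrite !coefM; apply: eq_bigr => k _.
rewrite pp ?qq//; last by rewrite (leq_trans _ im)// -ltnS.
by rewrite (leq_trans (leq_subr _ _)).
Qed.

Lemma moment_coef_low n (f g : {poly alg B}) m :
  (forall i, (i <= m)%N -> f`_i = g`_i) ->
  moment_coef iota Phi X n f m = moment_coef iota Phi X n g m.
Proof.
move=> fg; rewrite /moment_coef /insertion_poly; congr Phi.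
have fg' i : (i <= m)%N -> (map_poly iota f)`_i = (map_poly iota g)`_i.
  by move=> im; rewrite !coef_map fg.
apply: (coefM_low _ fg') => //; elim: n => [//|n IH] i im; rewrite !exprS.
apply: (coefM_low (m := m)) => // k km.
exact: (coefM_low fg').
Qed.

End Independence.

(** * Summation *)

Lemma sum_triangle (V : nmodType) (F : nat -> nat -> V) N :
  \sum_(k < N) \sum_(n < k.+1) F n (k - n)%N = \sum_(n < N) \sum_(m < N - n) F n m.
Proof.
elim: N => [|N IH]; first by rewrite !big_ord0.
rewrite big_ord_recr /= IH [RHS]big_ord_recr /= subSnn big_ord1.
rewrite big_ord_recr /= subnn addrA -big_split /=; congr (_ + _).
by apply: eq_bigr => n _; rewrite subSn ?big_ord_recr// ltnW.
Qed.

Lemma geom_le (R : realFieldType) (x : R) n : 0 <= x -> x <= 2^-1 ->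
  \sum_(i < n) x ^+ i <= 2.
Proof.
move=> x0 x2; have x1 : 0 < 1 - x by lra.
have := subrX1 x n => e.
rewrite -(ler_pM2l x1) -opprB mulNr -e opprB.
have : 0 <= x ^+ n by rewrite exprn_ge0.
by lra.
Qed.

Section Final.
Variables (R : realType) (B : cstarAlgType R) (A : starAlgType R[i]).
Variable iota : {lrmorphism alg B -> A}.
Hypothesis iota_star : star_preserving iota.
Variable Phi : A -> alg B.
Hypothesis PhiE : positive_conditional_expectation iota Phi.
Variables (Abar : completeNormedModType R[i]) (j : {linear A -> Abar}).
Variable Phibar : Abar -> B.
Hypothesis AbarP : is_closure Phi j Phibar.
Local Notation W := (realify B).
Local Notation moment := (moment iota Phi).
Local Notation h := (h iota j Phibar).
Local Notation hdef := (hdef iota j).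

Let jE : forall x : A, `|j x| ^+ 2 = `|(Phi (star x * x) : B)|.
Proof. by case: AbarP. Qed.

Definition moment_sum (X : A) (z : alg B) (N : nat) : W := \sum_(n < N) moment X n z.

Lemma moment_sum_cvg X z : hdef X z -> moment_sum X z @ \oo --> (h X z : W).
Proof.
case: AbarP => _ _ Pc Pj hz.
have e : moment_sum X z = Phibar \o resolvent_series iota j X z.
  apply/funext => N; rewrite /= /resolvent_series /series /=.
  by rewrite -(linear_sum j) Pj (Phi_sum PhiE) big_mkord.
by rewrite e; exact: cvg_comp hz (Pc _).
Qed.

Lemma hdef_moment_pointwise X z : hdef X z ->
  exists M : R, forall n, anorm (moment X n z) <= M.
Proof.
move=> /moment_sum_cvg hz.
have [M [_ MP]] := @cvg_seq_bounded R W (moment_sum X z) (cvgP _ hz).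
have {}MP n : anorm (moment_sum X z n) <= M + 1 by apply: (MP (M + 1)); [rewrite ltrDl|].
exists ((M + 1) + (M + 1)) => n.
have -> : moment X n z = (moment_sum X z n.+1 : alg B) - moment_sum X z n.
  by rewrite /moment_sum big_ord_recr /= addrAC subrr add0r.
by apply: le_trans (anormB _ _) _; apply: lerD.
Qed.

Lemma near0P (P : B -> Prop) :
  (\forall z \near (0 : B), P z) <->
  exists2 r : R, 0 < r & forall z : alg B, anorm z < r -> P z.
Proof.
have -> : (\forall z \near (0 : B), P z) = (\forall z \near (0 : W), P z) by [].
split.
  move=> /nbhs_normP[r r0 rP]; exists r => // z zr; apply: rP.
  by rewrite /ball_ /= sub0r normrN.
move=> [r r0 rP]; apply/nbhs_normP; exists r => // z.
by rewrite /ball_ /= sub0r normrN => zr; apply: rP.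
Qed.

Lemma hdef_moment_bounded X : (\forall z \near (0 : B), hdef X z) ->
  exists K M : R, [/\ 0 < K, 0 <= M &
    forall n z, anorm (moment X n z) <= M * (K * anorm z) ^+ n.+1].
Proof.
move=> /near0P[r r0 rP]; apply: (moment_bounded PhiE iota_star jE).
by exists r => // z /rP; exact: hdef_moment_pointwise.
Qed.

Lemma anorm_cvg_le (u : nat -> W) (l : W) (c : alg B) (M : R) :
  u @ \oo --> l -> (\forall n \near \oo, anorm ((u n : alg B) - c) <= M) ->
  anorm ((l : alg B) - c) <= M.
Proof.
move=> ul uM.
have H : (`|u n - (c : W)|) @[n --> \oo] --> `|l - (c : W)|.
  by apply: (@cvg_norm R W); apply: cvgB => //; exact: cvg_cst.
by apply: (@closed_cvg _ _ _ _ _ (fun y : R => y <= M) (@closed_le R M) _ _ H).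
Qed.

(** The remainder after [L] terms of the expansion of [moment X n w] in the
    degree.  For the partial sums of [w] the expansion is finite and Cauchy's
    estimate on the circle of radius 2 bounds its terms by [S 2^-m]; the partial
    sums tend to [w]. *)
Lemma moment_tail_le X Y n z (w : alg B) S L :
  moment_sum Y z @ \oo --> (w : W) -> 0 <= S ->
  (forall K t, complex.Re `|t| = 2 ->
     anorm (moment X n (\poly_(k < K) moment Y k z).[t%:A]) <= S) ->
  anorm (moment X n w -
    \sum_(m < L) moment_coef iota Phi X n (\poly_(k < L) moment Y k z) m) <=
  2 * S * 2^-1 ^+ L.
Proof.
move=> wz S0 le.
have tc : (moment X n : W -> W) (moment_sum Y z N) @[N --> \oo] --> (moment X n w : W).
  have tw := @moment_continuous _ _ _ iota _ PhiE iota_star _ j jE X n (w : W).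
  exact: cvg_comp _ _ wz tw.
apply: (anorm_cvg_le tc); near=> K.
have LK : (L <= K)%N by near: K; exact: nbhs_infty_ge.
pose f N : {poly alg B} := \poly_(k < N) moment Y k z.
have cle m : anorm (moment_coef iota Phi X n (f K) m) <= S / 2 ^+ m.
  by apply: (moment_coef_le PhiE) => // t; exact: le.
have -> : moment_sum Y z K = (f K).[1%:A].
  rewrite horner_poly; apply: eq_bigr => k _.
  by rewrite scale1r expr1n mulr1.
rewrite (moment_horner PhiE); set D := size _.
have -> : \sum_(m < L) moment_coef iota Phi X n (f L) m =
    \sum_(m < L) moment_coef iota Phi X n (f K) m.
  apply: eq_bigr => m _; apply: moment_coef_low => i im.
  have iL : (i < L)%N by apply: leq_ltn_trans im _.
  by rewrite !coef_poly iL (leq_trans iL).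
have -> : \sum_(m < D) 1 ^+ m *: moment_coef iota Phi X n (f K) m =
    \sum_(m < L + D) moment_coef iota Phi X n (f K) m.
  under eq_bigr do rewrite expr1n scale1r.
  rewrite addnC big_split_ord /= [X in _ = _ + X]big1 ?addr0// => i _.
  by rewrite /moment_coef nth_default ?(Phi0 PhiE)// leq_addr.
rewrite big_split_ord /= addrAC subrr add0r.
apply: le_trans (anorm_sum _ _ _) _.
apply: (@le_trans _ _ (\sum_(i < D) S * 2^-1 ^+ L * 2^-1 ^+ i)).
  by apply: ler_sum => i _; rewrite -mulrA -exprD exprVn.
rewrite -mulr_sumr [leRHS](_ : _ = S * 2^-1 ^+ L * 2); last by ring.
apply: ler_wpM2l; first by rewrite mulr_ge0// exprn_ge0// invr_ge0.
by apply: geom_le; rewrite ?invr_ge0.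
Unshelve. all: by end_near. Qed.

(** In the triangle [n + m < N] both partial sums have the same terms.  The rows
    [n < N] of the first one continue beyond it, with a tail of order
    [4^-(n+1) 2^-(N-n)] which sums to [2^-N]. *)
Lemma moment_sum_diff_le X Y z (w : alg B) (M : R) N :
  monotone_independent_elts iota Phi (fun i : bool => if i then Y else X) ->
  0 <= M -> moment_sum Y z @ \oo --> (w : W) ->
  (forall n K t, complex.Re `|t| = 2 ->
     anorm (moment X n (\poly_(k < K) moment Y k z).[t%:A]) <= M * 4^-1 ^+ n.+1) ->
  anorm ((moment_sum X w N : alg B) - moment_sum (X + Y) z N) <= M * 2^-1 ^+ N.
Proof.
move=> indep M0 wz le.
pose c K n m := moment_coef iota Phi X n (\poly_(k < K) moment Y k z) m.
have -> : moment_sum (X + Y) z N = \sum_(n < N) \sum_(m < N - n) c (N - n)%N n m.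
  rewrite /moment_sum (eq_bigr (fun k : 'I_N => \sum_(n < k.+1) c N n (k - n)%N)).
    rewrite sum_triangle; apply: eq_bigr => n _; apply: eq_bigr => m _.
    apply: moment_coef_low => i im.
    have iN : (i < N - n)%N by apply: leq_ltn_trans im _.
    by rewrite !coef_poly iN (leq_trans iN)// leq_subr.
  by move=> k _; rewrite (moment_add PhiE indep z (ltn_ord k)).
rewrite /moment_sum -sumrB; apply: le_trans (anorm_sum _ _ _) _.
apply: (@le_trans _ _ (\sum_(n < N) M / 2 * 2^-1 ^+ N * 2^-1 ^+ n)).
  apply: ler_sum => n _.
  apply: le_trans (moment_tail_le _ wz _ (le n)) _.
    by rewrite mulr_ge0// exprn_ge0// invr_ge0.
  rewrite le_eqVlt; apply/orP; left; apply/eqP.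
  have -> : 2^-1 ^+ N = 2^-1 ^+ (N - n) * 2^-1 ^+ n :> R.
    by rewrite -exprD subnK// ltnW.
  have -> : 4^-1 = 2^-1 * 2^-1 :> R by field.
  by rewrite exprS exprMn; field.
rewrite -mulr_sumr [leRHS](_ : _ = M / 2 * 2^-1 ^+ N * 2); last by field.
apply: ler_wpM2l; first by rewrite !mulr_ge0 ?exprn_ge0 ?invr_ge0.
by apply: geom_le; rewrite ?invr_ge0.
Qed.

Lemma near0_small (C e : R) : 0 < e ->
  \forall z \near (0 : B), C * anorm (z : alg B) < e.
Proof.
move=> e0; apply/near0P; have C0 : 0 < `|C| + 1 by rewrite ltr_wpDl.
exists (e / (`|C| + 1)); first exact: divr_gt0.
move=> z; rewrite ltr_pdivlMr// mulrC; apply: le_lt_trans.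
rewrite ler_wpM2r ?anorm_ge0//; apply: le_trans (ler_norm C) _.
by rewrite lerDl.
Qed.

Lemma poly_sum_le Y K M z t N :
  (forall n, anorm (moment Y n z) <= M * (K * anorm z) ^+ n.+1) ->
  0 <= M -> 0 <= K -> 4 * (K * anorm z) <= 1 -> 0 <= t -> t <= 2 ->
  \sum_(k < N) t ^+ k * anorm (moment Y k z) <= 2 * M * (K * anorm z).
Proof.
move=> le M0 K0; set q := K * anorm z => q4 t0 t2.
have q0 : 0 <= q by rewrite mulr_ge0 ?anorm_ge0.
apply: (@le_trans _ _ (\sum_(k < N) M * q * (t * q) ^+ k)).
  apply: ler_sum => k _; apply: le_trans (ler_wpM2l (exprn_ge0 _ t0) (le k)) _.
  by rewrite -/q exprS [(t * q) ^+ k]exprMn le_eqVlt; apply/orP; left; apply/eqP; ring.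
rewrite -mulr_sumr [leRHS](_ : _ = M * q * 2); last by ring.
apply: ler_wpM2l; first by rewrite mulr_ge0.
by apply: geom_le; [rewrite mulr_ge0 | nra].
Qed.
End Final.

Theorem theorem3p2 (R : realType) (B : cstarAlgType R) (A : starAlgType R[i])
    (iota : {lrmorphism alg B -> A}) (iota_star : star_preserving iota)
    (Phi : A -> alg B) (PhiE : positive_conditional_expectation iota Phi)
    (Abar : completeNormedModType R[i]) (j : {linear A -> Abar})
    (Phibar : Abar -> B) (AbarP : is_closure Phi j Phibar)
    (X Y : A)
    (hX_def : \forall z \near (0 : B), hdef iota j X z)
    (hY_def : \forall z \near (0 : B), hdef iota j Y z)
    (hXY_def : \forall z \near (0 : B), hdef iota j (X + Y) z)
    (indep : monotone_independent_elts iota Phi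
               (fun i : bool => if i then Y else X)) :
  \forall z \near (0 : B),
    hdef iota j X (h iota j Phibar Y z) /\
    h iota j Phibar (X + Y) z = (h iota j Phibar X \o h iota j Phibar Y) z.
Proof.
have [Kx [Mx [Kx0 Mx0 leX]]] := hdef_moment_bounded iota_star PhiE AbarP hX_def.
have [Ky [My [Ky0 My0 leY]]] := hdef_moment_bounded iota_star PhiE AbarP hY_def.
have /near0P[d d0 dX] := hX_def.
near=> z.
set w : alg B := h iota j Phibar Y z.
have hYz : hdef iota j Y z by near: z.
have hXYz : hdef iota j (X + Y) z by near: z.
(* The three smallness conditions on Ky |z|: the geometric series in [poly_sum_le]
   has ratio at most 1/2; the value w of h_Y at z lies where h_X is defined; on
   the circle of radius 2 the moments of X decay like 4^-(n+1). *)
have q4 : 4 * (Ky * anorm (z : alg B)) <= 1.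
  by rewrite mulrA ltW//; near: z; exact: near0_small.
have qd : 2 * My * (Ky * anorm (z : alg B)) < d.
  by rewrite mulrA; near: z; exact: near0_small.
have qK : Kx * (2 * My * (Ky * anorm (z : alg B))) <= 4^-1.
  have -> : Kx * (2 * My * (Ky * anorm (z : alg B))) =
    Kx * (2 * My * Ky) * anorm (z : alg B) by ring.
  by rewrite ltW//; near: z; apply: near0_small; rewrite invr_gt0.
have sum_le := poly_sum_le _ (leY ^~ z) My0 (ltW Ky0) q4.
have wz := moment_sum_cvg PhiE AbarP hYz; rewrite -/w in wz.
have hXw : hdef iota j X w.
  apply: dX; apply: le_lt_trans qd; rewrite -[w]subr0.
  apply: (anorm_cvg_le wz); near=> N; rewrite subr0.
  apply: le_trans (anorm_sum _ _ _) _.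
  have := sum_le 1 N ler01 (ler1n _ _).
  by under eq_bigr do rewrite expr1n mul1r.
split=> //=.
have le n K (t : R[i]) : complex.Re `|t| = 2 ->
    anorm (moment iota Phi X n (\poly_(k < K) moment iota Phi Y k z).[t%:A]) <=
    Mx * 4^-1 ^+ n.+1.
  move=> t2; apply: le_trans (leX _ _) _; apply: ler_wpM2l => //.
  apply: lerXn2r; rewrite ?nnegrE ?mulr_ge0 ?anorm_ge0 ?(ltW Kx0) ?invr_ge0//.
  apply: le_trans qK; rewrite ler_pM2l// horner_poly.
  apply: le_trans (anorm_sum _ _ _) _.
  have := sum_le 2 K (ler0n _ _) (lexx _).
  apply: le_trans; apply: ler_sum => k _.
  rewrite exprZn expr1n -scalerAr mulr1 anormZ normrX normc_re t2 -rmorphXn.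
  exact: lexx.
have le0 N := moment_sum_diff_le iota_star PhiE AbarP N indep Mx0 wz le.
have cX := moment_sum_cvg PhiE AbarP hXw.
have cXY := moment_sum_cvg PhiE AbarP hXYz.
apply/esym/subr0_eq.
suff e0 e : 0 < e ->
    anorm ((h iota j Phibar X w : alg B) - h iota j Phibar (X + Y) z) <= e.
  apply: (@nrm_eq0 R B); apply/eqP; rewrite eq_le nrm_ge0 andbT.
  by apply/ler_addgt0Pr => e /e0; rewrite add0r.
move=> epos; have h1 : `|2^-1 : R| < 1.
  by rewrite ger0_norm ?invr_ge0// invf_lt1 ?ltr1n.
have small := @cvgr0_norm_le R R^o _ _ _ _ (@cvg_geometric R Mx _ h1) e epos.
rewrite -[X in anorm X]subr0; apply: (anorm_cvg_le (cvgB cX cXY)).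
near=> N; rewrite subr0; apply: le_trans (le0 N) (le_trans (ler_norm _) _).
by near: N; exact: small.
Unshelve. all: by end_near.
Qed.
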